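(* Let $\zeta\in\overline{\mathbb{D}}$ and let $\phi(z)=\zeta|z|^{k}z$, where $k\ge 0$, be an analytic function on the unit disc $\mathbb{D}$. Then the Berezin range of the composition operator $C_\phi$ acting on $H^2(\mathbb{D})$ is convex if and only if $\zeta\in[-1,1]$.
   Context: $\mathbb{D}$ is the open unit disc in $\mathbb{C}$ and $\overline{\mathbb{D}}$ its closure. $H^2(\mathbb{D})$ is the Hardy space of holomorphic functions $f(z)=\sum_{n\ge0}a_nz^n$ on $\mathbb{D}$ with $\sum_{n\ge0}|a_n|^2<\infty$, with inner product $\langle f,g\rangle=\sum_{n\ge0}a_n\overline{b_n}$ for $g(z)=\sum_{n\ge0}b_nz^n$. It is a reproducing kernel Hilbert space with kernel $k_w(z)=\frac{1}{1-\bar w z}$, and $\|k_\lambda\|^2=\frac{1}{1-|\lambda|^2}$; the normalized kernel is $\hat k_\lambda=k_\lambda/\|k_\lambda\|$. For $\phi:\mathbb{D}\to\mathbb{D}$, the composition operator on $H^2(\mathbb{D})$ is $C_\phi f=f\circ\phi$. The Berezin transform of $C_\phi$ at $\lambda\in\mathbb{D}$ is $\widetilde{C_\phi}(\lambda)=\langle C_\phi\hat k_\lambda,\hat k_\lambda\rangle$, which equals $(1-|\lambda|^2)\,k_\lambda(\phi(\lambda))$. The Berezin range of $C_\phi$ is the set $\mathrm{Ber}(C_\phi)=\{\widetilde{C_\phi}(\lambda):\lambda\in\mathbb{D}\}\subseteq\mathbb{C}$. *)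

(* Defs.v *)
From Stdlib Require Import Reals ClassicalEpsilon.
From Coquelicot Require Import Coquelicot.

Open Scope R_scope.
Open Scope C_scope.

Definition in_disc (z : C) : Prop := (Cmod z < 1)%R.

Definition in_closed_disc (z : C) : Prop := (Cmod z <= 1)%R.

(* Complex differentiability at every point of the open disc. *)
Definition analytic_on_disc (f : C -> C) : Prop :=
  forall z : C, in_disc z ->
    ex_derive (K := C_AbsRing) (V := C_NormedModule) f z.

(* Elements of H^2 are represented by functions on all of C; only their values
   on the open disc matter. *)
Definition H2_expansion (f : C -> C) (a : nat -> C) : Prop :=
  (forall z : C, in_disc z ->
     is_pseries (K := C_AbsRing) (V := C_NormedModule) a z (f z)) /\
  ex_series (fun n : nat => (Cmod (a n) ^ 2)%R).

Definition in_H2 (f : C -> C) : Prop := exists a : nat -> C, H2_expansion f a.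

(* The expansion of a function in H^2 is unique, so this is its sequence of
   Taylor coefficients; it is unspecified when f is not in H^2. *)
Definition H2_coef (f : C -> C) : nat -> C :=
  epsilon (inhabits (fun _ : nat => RtoC 0)) (H2_expansion f).

Definition CSeries (u : nat -> C) : C :=
  (Series (fun n : nat => Re (u n)), Series (fun n : nat => Im (u n))).

Definition H2_inner (f g : C -> C) : C :=
  CSeries (fun n : nat => H2_coef f n * Cconj (H2_coef g n)).

Definition H2_norm (f : C -> C) : R := sqrt (Re (H2_inner f f)).

Definition szego_kernel (w z : C) : C := / (1 - Cconj w * z).

Definition normalized_kernel (w z : C) : C :=
  szego_kernel w z / RtoC (H2_norm (szego_kernel w)).

Definition composition_operator (phi f : C -> C) : C -> C :=
  fun z : C => f (phi z).

Definition berezin_transform (T : (C -> C) -> (C -> C)) (lambda : C) : C :=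
  H2_inner (T (normalized_kernel lambda)) (normalized_kernel lambda).

Definition berezin_range (T : (C -> C) -> (C -> C)) (w : C) : Prop :=
  exists lambda : C, in_disc lambda /\ w = berezin_transform T lambda.

Definition convex_subset (A : C -> Prop) : Prop :=
  forall (x y : C) (t : R), A x -> A y -> (0 <= t <= 1)%R ->
    A (RtoC (1 - t) * x + RtoC t * y).

(* The value of Rpower at base 0 is irrelevant here: the factor z makes the
   product 0 at z = 0. *)
Definition radial_map (zeta : C) (k : R) (z : C) : C :=
  zeta * RtoC (Rpower (Cmod z) k) * z.

(* Main.v *)
Require Import Defs.
From Stdlib Require Import Reals Lra ClassicalEpsilon.
From Coquelicot Require Import Coquelicot.

(** Analyticity at [1/2] already forces [k = 0] or [zeta = 0]: on the circle
    [|z| = 1/2] the map is linear, which fixes the derivative, while along the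
    real axis the difference quotient has the extra term [zeta k 2^-k]. Hence
    [phi z = zeta z], and geometric series give the Berezin range
    [{(1 - s) / (1 - zeta s) : 0 <= s < 1}]. For real [zeta] this is [{1}] or
    [(0,1]]; otherwise it is a circular arc, and the midpoint of its points at
    [s = 0] and [s = 1/2] is not on it. *)

Local Open Scope R_scope.
Local Open Scope C_scope.

(** * Complex series through their real and imaginary parts *)

Notation is_series_C := (is_series (K := C_AbsRing) (V := C_NormedModule)).

Lemma RtoC_neq (x y : R) : x <> y -> RtoC x <> RtoC y.
Proof. intros H E; exact (H (RtoC_inj _ _ E)). Qed.

Lemma Re_sum_n (u : nat -> C) (n : nat) :
  Re (@sum_n C_AbelianMonoid u n) = sum_n (fun k => Re (u k)) n.
Proof.
  induction n as [|n IH]; [now rewrite !sum_O|].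
  rewrite !sum_Sn, <- IH; reflexivity.
Qed.

Lemma Im_sum_n (u : nat -> C) (n : nat) :
  Im (@sum_n C_AbelianMonoid u n) = sum_n (fun k => Im (u k)) n.
Proof.
  induction n as [|n IH]; [now rewrite !sum_O|].
  rewrite !sum_Sn, <- IH; reflexivity.
Qed.

Lemma is_series_Re (u : nat -> C) (l : C) :
  is_series_C u l -> is_series (fun n => Re (u n)) (Re l).
Proof.
  intros H; unfold is_series.
  apply filterlim_ext with (1 := Re_sum_n u).
  apply filterlim_comp with (1 := H).
  apply (continuous_fst (U := R_UniformSpace) (V := R_UniformSpace)).
Qed.

Lemma is_series_Im (u : nat -> C) (l : C) :
  is_series_C u l -> is_series (fun n => Im (u n)) (Im l).
Proof.
  intros H; unfold is_series.
  apply filterlim_ext with (1 := Im_sum_n u).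
  apply filterlim_comp with (1 := H).
  apply (continuous_snd (U := R_UniformSpace) (V := R_UniformSpace)).
Qed.

Lemma CSeries_unique (u : nat -> C) (l : C) : is_series_C u l -> CSeries u = l.
Proof.
  intros H; unfold CSeries.
  rewrite (is_series_unique _ _ (is_series_Re _ _ H)).
  rewrite (is_series_unique _ _ (is_series_Im _ _ H)).
  now destruct l.
Qed.

(** * The complex geometric series *)

Lemma one_minus_neq_0 (q : C) : (Cmod q < 1)%R -> 1 - q <> 0.
Proof.
  intros Hq H.
  assert (E : q = 1) by (replace q with (1 - (1 - q)) by ring; rewrite H; ring).
  rewrite E, Cmod_1 in Hq; lra.
Qed.

(** Splitting the closed form into its limit and a multiple of [q ^ n] reduces convergence to
    [q ^ n] tending to 0. *)
Lemma sum_n_geom (q : C) (n : nat) :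
  1 - q <> 0 ->
  @sum_n C_AbelianMonoid (fun k => q ^ k) n = / (1 - q) + (- q / (1 - q)) * q ^ n.
Proof.
  intros Hq; induction n as [|n IH].
  - rewrite sum_O; simpl; field; exact Hq.
  - rewrite sum_Sn, IH, Cpow_S; unfold plus; simpl; field; exact Hq.
Qed.

Lemma is_series_geom_C (q : C) :
  (Cmod q < 1)%R -> is_series_C (fun n => q ^ n) (/ (1 - q)).
Proof.
  intros Hq.
  pose proof (one_minus_neq_0 q Hq) as Hq1.
  assert (Hpow : filterlim (fun n => q ^ n) eventually
                   (locally (T := C_NormedModule) (@zero C_NormedModule))).
  { apply (filterlim_norm_zero (K := C_AbsRing) (V := C_NormedModule)).
    apply (filterlim_ext (fun n => (Cmod q ^ n)%R)).
    - intros n; symmetry; exact (Cmod_pow q n).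
    - apply (is_lim_seq_geom (Cmod q)).
      rewrite Rabs_pos_eq; [exact Hq | apply Cmod_ge_0]. }
  unfold is_series.
  apply (filterlim_ext (fun n =>
    plus (/ (1 - q) : C_NormedModule) (scal (- q / (1 - q) : C_AbsRing) (q ^ n : C_NormedModule)))).
  { intros n; symmetry; exact (sum_n_geom q n Hq1). }
  (* The limit is written with a scaled zero summand so that it matches the limit laws for [plus]
     and [scal]. *)
  assert (E : (/ (1 - q) : C) =
    plus (/ (1 - q) : C_NormedModule) (scal (- q / (1 - q) : C_AbsRing) zero))
    by (change (/ (1 - q) = / (1 - q) + - q / (1 - q) * 0); ring).
  refine (eq_ind _ (fun l : C_NormedModule => filterlim _ eventually (locally l)) _ _
            (eq_sym E)).
  eapply filterlim_comp_2;
    [apply filterlim_const | | apply (filterlim_plus (K := C_AbsRing) (V := C_NormedModule))].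
  eapply filterlim_comp;
    [exact Hpow | apply (filterlim_scal_r (K := C_AbsRing) (V := C_NormedModule))].
Qed.

(** * Uniqueness of Taylor coefficients *)

(** With radius 0, the point [x] would lie outside the disc of convergence, where the terms cannot
    tend to 0. *)
Lemma ex_pseries_CV_radius_pos (a : nat -> R) (x : R) :
  x <> 0%R -> ex_pseries a x -> Rbar_lt 0 (CV_radius a).
Proof.
  intros Hx [l Hl].
  destruct (Rbar_le_lt_dec (CV_radius a) 0) as [H|H]; [exfalso|exact H].
  apply (CV_disk_outside a x).
  - eapply Rbar_le_lt_trans; [exact H|].
    exact (Rabs_pos_lt x Hx).
  - apply ex_series_lim_0; exists l; now apply is_pseries_R.
Qed.

(** On the real axis the powers are real, so real parts of coefficients form a real power series;
    this brings complex uniqueness down to the real one. *)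
Lemma H2_expansion_Re (f : C -> C) (a : nat -> C) (x : R) :
  H2_expansion f a -> (Rabs x < 1)%R ->
  is_pseries (fun n => Re (a n)) x (Re (f (RtoC x))).
Proof.
  intros [H _] Hx; apply is_pseries_R.
  eapply is_series_ext; [|apply is_series_Re, H; red; now rewrite Cmod_R].
  intros n; change (Re (RtoC x ^ n * a n) = Re (a n) * x ^ n)%R.
  rewrite <- RtoC_pow, re_scal_l; ring.
Qed.

Lemma H2_expansion_Im (f : C -> C) (a : nat -> C) (x : R) :
  H2_expansion f a -> (Rabs x < 1)%R ->
  is_pseries (fun n => Im (a n)) x (Im (f (RtoC x))).
Proof.
  intros [H _] Hx; apply is_pseries_R.
  eapply is_series_ext; [|apply is_series_Im, H; red; now rewrite Cmod_R].
  intros n; change (Im (RtoC x ^ n * a n) = Im (a n) * x ^ n)%R.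
  rewrite <- RtoC_pow, im_scal_l; ring.
Qed.

Lemma pseries_coef_unique (a b : nat -> R) (g : R -> R) (n : nat) :
  (forall x, Rabs x < 1 -> is_pseries a x (g x))%R ->
  (forall x, Rabs x < 1 -> is_pseries b x (g x))%R -> a n = b n.
Proof.
  intros Ha Hb.
  (* Any nonzero point of the interval would serve: convergence there makes both radii positive. *)
  assert (H2 : (Rabs (/ 2) < 1)%R) by (rewrite Rabs_pos_eq; lra).
  apply PSeries_ext_recip.
  - apply ex_pseries_CV_radius_pos with (/ 2)%R; [lra | eexists; now apply Ha].
  - apply ex_pseries_CV_radius_pos with (/ 2)%R; [lra | eexists; now apply Hb].
  - exists (mkposreal 1 Rlt_0_1); intros x Hx.
    assert (Hx1 : (Rabs x < 1)%R).
    { unfold ball in Hx; simpl in Hx.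
      unfold AbsRing_ball, abs, minus, plus, opp in Hx; simpl in Hx.
      now rewrite Ropp_0, Rplus_0_r in Hx. }
    now rewrite (is_pseries_unique _ _ _ (Ha x Hx1)), (is_pseries_unique _ _ _ (Hb x Hx1)).
Qed.

Lemma H2_expansion_unique (f : C -> C) (a b : nat -> C) (n : nat) :
  H2_expansion f a -> H2_expansion f b -> a n = b n.
Proof.
  intros Ha Hb.
  assert (HR : Re (a n) = Re (b n))
    by (apply (pseries_coef_unique (fun k => Re (a k)) (fun k => Re (b k))
                 (fun x => Re (f (RtoC x)))); intros; now apply H2_expansion_Re).
  assert (HI : Im (a n) = Im (b n))
    by (apply (pseries_coef_unique (fun k => Im (a k)) (fun k => Im (b k))
                 (fun x => Im (f (RtoC x)))); intros; now apply H2_expansion_Im).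
  now apply injective_projections.
Qed.

(** The sequence picked by [epsilon] is some expansion of [f], and uniqueness identifies it with the
    given one. *)
Lemma H2_coef_eq (f : C -> C) (a : nat -> C) (n : nat) :
  H2_expansion f a -> H2_coef f n = a n.
Proof.
  intros H; apply (H2_expansion_unique f); [|exact H].
  unfold H2_coef; apply epsilon_spec; now exists a.
Qed.

(** * Inner products of functions with geometric coefficients *)

Lemma H2_expansion_geom (f : C -> C) (s c : C) :
  (Cmod c < 1)%R ->
  (forall z, in_disc z -> f z = s * / (1 - c * z)) ->
  H2_expansion f (fun n => s * c ^ n).
Proof.
  intros Hc Hf; split.
  - intros z Hz; rewrite (Hf z Hz).
    assert (Hcz : (Cmod (c * z) < 1)%R).
    { rewrite Cmod_mult; red in Hz.
      pose proof (Cmod_ge_0 c); pose proof (Cmod_ge_0 z); nra. }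
    unfold is_pseries.
    eapply is_series_ext;
      [|exact (is_series_scal (K := C_AbsRing) (V := C_NormedModule) s _ _
                 (is_series_geom_C _ Hcz))].
    intros n.
    change (s * (c * z) ^ n = z ^ n * (s * c ^ n)).
    rewrite Cpow_mult_l; ring.
  - assert (Hq : (Rabs (Cmod c ^ 2) < 1)%R).
    { pose proof (Cmod_ge_0 c); rewrite Rabs_pos_eq; nra. }
    eapply ex_series_ext;
      [|exact (ex_series_scal (V := R_NormedModule) (Cmod s ^ 2)%R _
                 (ex_intro _ _ (is_series_geom _ Hq)))].
    intros n; change (Cmod s ^ 2 * (Cmod c ^ 2) ^ n = Cmod (s * c ^ n) ^ 2)%R.
    rewrite Cmod_mult, Cmod_pow, Rpow_mult_distr, <- !pow_mult.
    now rewrite (PeanoNat.Nat.mul_comm 2).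
Qed.

(** The termwise products are again geometric, with ratio [c * Cconj d]. This one formula yields
    both the kernel norm and the Berezin transform. *)
Lemma H2_inner_geom (f g : C -> C) (s c t d : C) :
  (Cmod c < 1)%R -> (Cmod d < 1)%R ->
  (forall z, in_disc z -> f z = s * / (1 - c * z)) ->
  (forall z, in_disc z -> g z = t * / (1 - d * z)) ->
  H2_inner f g = s * Cconj t * / (1 - c * Cconj d).
Proof.
  intros Hc Hd Hf Hg; apply CSeries_unique.
  assert (Hcd : (Cmod (c * Cconj d) < 1)%R).
  { rewrite Cmod_mult, Cmod_conj.
    pose proof (Cmod_ge_0 c); pose proof (Cmod_ge_0 d); nra. }
  eapply is_series_ext;
    [|exact (is_series_scal (K := C_AbsRing) (V := C_NormedModule) (s * Cconj t) _ _
               (is_series_geom_C _ Hcd))].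
  intros n.
  change (s * Cconj t * (c * Cconj d) ^ n = H2_coef f n * Cconj (H2_coef g n)).
  rewrite (H2_coef_eq f _ n (H2_expansion_geom f s c Hc Hf)).
  rewrite (H2_coef_eq g _ n (H2_expansion_geom g t d Hd Hg)).
  rewrite Cmult_conj, Cpow_conj, Cpow_mult_l; ring.
Qed.

(** * The Berezin transform for a linear symbol *)

Lemma in_disc_mult_closed (a z : C) :
  (Cmod a <= 1)%R -> in_disc z -> in_disc (a * z).
Proof.
  unfold in_disc; intros Ha Hz; rewrite Cmod_mult.
  pose proof (Cmod_ge_0 a); pose proof (Cmod_ge_0 z); nra.
Qed.

Lemma Cmult_Cconj (w : C) : w * Cconj w = RtoC (Cmod w ^ 2).
Proof.
  rewrite Cmod2_alt; destruct w as [x y].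
  unfold Cmult, Cconj, RtoC, Re, Im; simpl; f_equal; ring.
Qed.

Lemma H2_norm_szego_kernel (w : C) :
  in_disc w -> H2_norm (szego_kernel w) = sqrt (/ (1 - Cmod w ^ 2)).
Proof.
  intros Hw; unfold H2_norm.
  assert (Hw' : (Cmod (Cconj w) < 1)%R) by now rewrite Cmod_conj.
  rewrite (H2_inner_geom _ _ 1 (Cconj w) 1 (Cconj w) Hw' Hw');
    try (intros z _; unfold szego_kernel; ring).
  rewrite Cconj_conj, (Cmult_comm (Cconj w) w), !Cmult_Cconj, Cmod_1.
  assert (H : (1 - Cmod w ^ 2 <> 0)%R)
    by (pose proof (Cmod_ge_0 w); red in Hw; nra).
  rewrite <- RtoC_minus, <- RtoC_inv by exact H.
  rewrite <- RtoC_mult; f_equal; simpl; ring.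
Qed.

(** Composing a kernel with multiplication by [zeta] only multiplies its geometric ratio by [zeta],
    so [H2_inner_geom] applies; the two normalizations contribute the numerator. *)
Lemma berezin_transform_linear (phi : C -> C) (zeta lambda : C) :
  (Cmod zeta <= 1)%R -> (forall z, phi z = zeta * z) -> in_disc lambda ->
  berezin_transform (composition_operator phi) lambda =
  RtoC (1 - Cmod lambda ^ 2) / (1 - zeta * RtoC (Cmod lambda ^ 2)).
Proof.
  intros Hzeta Hphi Hl.
  assert (Hl' : in_disc (Cconj lambda)) by (red; now rewrite Cmod_conj).
  assert (Hpos : (0 < 1 - Cmod lambda ^ 2)%R)
    by (pose proof (Cmod_ge_0 lambda); red in Hl; nra).
  set (N := H2_norm (szego_kernel lambda)).
  assert (HN : (N * N = / (1 - Cmod lambda ^ 2))%R).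
  { unfold N; rewrite H2_norm_szego_kernel by exact Hl.
    apply sqrt_sqrt, Rlt_le, Rinv_0_lt_compat, Hpos. }
  assert (HN0 : N <> 0%R).
  { intros E; rewrite E, Rmult_0_l in HN.
    pose proof (Rinv_0_lt_compat _ Hpos); lra. }
  unfold berezin_transform.
  rewrite (H2_inner_geom _ _ (RtoC (/ N)) (zeta * Cconj lambda) (RtoC (/ N)) (Cconj lambda)).
  - rewrite Cconj_conj.
    replace (zeta * Cconj lambda * lambda) with (zeta * (lambda * Cconj lambda)) by ring.
    rewrite (Cmult_Cconj lambda).
    replace (Cconj (RtoC (/ N))) with (RtoC (/ N))
      by (unfold Cconj, RtoC; simpl; now rewrite Ropp_0).
    rewrite <- RtoC_mult; unfold Cdiv; f_equal; f_equal.
    rewrite <- Rinv_mult, HN; apply Rinv_inv.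
  - now apply in_disc_mult_closed.
  - exact Hl'.
  - intros z _; unfold composition_operator, normalized_kernel, szego_kernel.
    fold (szego_kernel lambda); fold N.
    rewrite Hphi, RtoC_inv by exact HN0.
    replace (zeta * Cconj lambda * z) with (Cconj lambda * (zeta * z)) by ring.
    unfold Cdiv; ring.
  - intros z _; unfold normalized_kernel; fold N.
    rewrite RtoC_inv by exact HN0; unfold szego_kernel, Cdiv; ring.
Qed.

(** * Consequences of analyticity at 1/2 *)

Lemma is_derive_C_estimate (f : C -> C) (z l : C) :
  is_derive (K := C_AbsRing) (V := C_NormedModule) f z l ->
  forall eps : posreal, exists d : posreal, forall y : C,
    (Cmod (y - z) < d)%R -> (Cmod (f y - f z - (y - z) * l) <= eps * Cmod (y - z))%R.
Proof.
  intros [_ H] eps.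
  (* The filter is [locally z] itself, so its convergence to [z] is the identity. *)
  destruct (H z (fun P HP => HP) eps) as [d Hd].
  exists d; exact Hd.
Qed.

Lemma C_eq_of_Cmod_le (u v : C) :
  (forall eps : posreal, Cmod (u - v) <= eps)%R -> u = v.
Proof.
  intros H.
  assert (E : u - v = 0).
  { apply Cmod_eq_0, Rle_antisym; [|apply Cmod_ge_0].
    apply Rnot_lt_le; intros Hlt.
    assert (Hpos : (0 < Cmod (u - v) / 2)%R) by lra.
    specialize (H (mkposreal _ Hpos)); simpl in H; lra. }
  replace u with (u - v + v) by ring; rewrite E; ring.
Qed.

Lemma radial_map_derive_half (zeta l : C) (k : R) :
  is_derive (K := C_AbsRing) (V := C_NormedModule)
    (radial_map zeta k) (RtoC (/ 2)) l ->
  l = zeta * RtoC (Rpower (/ 2) k).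
Proof.
  intros Hl; symmetry; apply C_eq_of_Cmod_le; intros eps.
  destruct (is_derive_C_estimate _ _ _ Hl eps) as [d Hd].
  set (t := (d / 2)%R).
  assert (Ht : (0 < t < d)%R) by (unfold t; destruct d; simpl; lra).
  (* A rational point of the circle [|z| = 1/2] within [d] of [1/2]. *)
  set (y := ((1 - t ^ 2) / (1 + t ^ 2) / 2, t / (1 + t ^ 2))%R : C).
  assert (Ht2 : (0 < t ^ 2)%R) by (apply pow_lt; lra).
  assert (Hy : Cmod y = (/ 2)%R).
  { unfold Cmod, y; simpl fst; simpl snd.
    rewrite <- (sqrt_pow2 (/ 2)) by lra; f_equal; field; lra. }
  assert (Hsq : (Cmod (y - RtoC (/ 2)) ^ 2 = t ^ 2 / (1 + t ^ 2))%R).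
  { rewrite Cmod2_alt; unfold y, RtoC, Re, Im, Cminus, Cplus, Copp; simpl fst; simpl snd.
    field; lra. }
  assert (Hle : (t ^ 2 / (1 + t ^ 2) < d ^ 2)%R).
  { apply Rle_lt_trans with (t ^ 2)%R; [|nra].
    apply Rmult_le_reg_r with (1 + t ^ 2)%R; [lra|].
    unfold Rdiv; rewrite Rmult_assoc, Rinv_l by lra; nra. }
  (* This keeps [y] different from 1/2, so that the factor [Cmod (y - RtoC (/ 2))] can be cancelled
     at the end. *)
  assert (Hpos : (0 < t ^ 2 / (1 + t ^ 2))%R)
    by (apply Rdiv_lt_0_compat; lra).
  pose proof (Cmod_ge_0 (y - RtoC (/ 2))) as Hge.
  assert (Hc : (Cmod (y - RtoC (/ 2)) < d)%R) by (destruct d; simpl in *; nra).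
  specialize (Hd y Hc).
  replace (radial_map zeta k y - radial_map zeta k (RtoC (/ 2)) - (y - RtoC (/ 2)) * l)
    with ((zeta * RtoC (Rpower (/ 2) k) - l) * (y - RtoC (/ 2))) in Hd.
  - rewrite Cmod_mult in Hd.
    apply Rmult_le_reg_r with (2 := Hd); nra.
  - unfold radial_map; rewrite Hy, Cmod_R, (Rabs_pos_eq (/ 2)) by lra; ring.
Qed.

(** After factoring out 1/2, the bound is [exp x >= 1 + x] at [x = k * ln (1 + 2 * h)]. That
    [h <= ln (1 + 2 * h)] follows from [exp (- h) >= 1 - h] and [(1 - h) * (1 + 2 * h) >= 1], which
    holds up to [h = 1/2]. *)
Lemma Rpower_half_lower (k h : R) :
  (0 <= k -> 0 < h <= / 2 ->
   Rpower (/ 2) k * (1 + k * h) <= Rpower (/ 2 + h) k)%R.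
Proof.
  intros Hk Hh.
  assert (Hln : (h <= ln (1 + 2 * h))%R).
  { rewrite <- (ln_exp h) at 1; apply ln_le; [apply exp_pos|].
    assert (H : (exp (- h) >= 1 - h)%R) by (pose proof (exp_ineq1_le (- h)); lra).
    assert (E : (exp h * exp (- h) = 1)%R)
      by (rewrite <- exp_plus, Rplus_opp_r; apply exp_0).
    pose proof (exp_pos h); nra. }
  replace (/ 2 + h)%R with (/ 2 * (1 + 2 * h))%R by field.
  rewrite <- Rpower_mult_distr by lra.
  apply Rmult_le_compat_l; [apply Rlt_le, exp_pos|].
  unfold Rpower; pose proof (exp_ineq1_le (k * ln (1 + 2 * h))); nra.
Qed.

Lemma radial_map_analytic (zeta : C) (k : R) :
  (0 <= k)%R -> analytic_on_disc (radial_map zeta k) -> k = 0%R \/ zeta = 0.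
Proof.
  intros Hk H.
  assert (Hdisc : in_disc (RtoC (/ 2)))
    by (red; rewrite Cmod_R, Rabs_pos_eq; lra).
  destruct (H _ Hdisc) as [l Hl].
  pose proof (radial_map_derive_half _ _ _ Hl) as El.
  set (P := Rpower (/ 2) k) in El.
  assert (HP : (0 < P)%R) by apply exp_pos.
  destruct (Req_dec k 0) as [E|Hk0]; [now left|right].
  apply C_eq_of_Cmod_le; intros eps.
  replace (zeta - 0) with zeta by ring.
  assert (Hc : (0 < P * k / 2)%R) by (apply Rdiv_lt_0_compat; nra).
  (* The remainder along the real axis has modulus at least [Cmod zeta * (P * k / 2) * h]; this
     tolerance therefore leaves [Cmod zeta <= eps]. *)
  assert (Heps : (0 < eps * (P * k / 2))%R) by (destruct eps; simpl; nra).
  destruct (is_derive_C_estimate _ _ _ Hl (mkposreal _ Heps)) as [d Hd].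
  simpl in Hd.
  set (h := Rmin (d / 2) (/ 2)).
  assert (Hh : (0 < h <= / 2 /\ h < d)%R).
  { unfold h; pose proof (Rmin_l (d / 2) (/ 2)); pose proof (Rmin_r (d / 2) (/ 2)).
    destruct d as [d Hd0]; simpl in *.
    split; [split; [apply Rmin_glb_lt; lra|lra]|lra]. }
  destruct Hh as [Hh Hhd].
  assert (Em : Cmod (RtoC (/ 2 + h) - RtoC (/ 2)) = h).
  { rewrite <- RtoC_minus, Cmod_R, Rabs_pos_eq; lra. }
  specialize (Hd (RtoC (/ 2 + h))); rewrite Em in Hd; specialize (Hd Hhd).
  replace (radial_map zeta k (RtoC (/ 2 + h)) - radial_map zeta k (RtoC (/ 2))
           - (RtoC (/ 2 + h) - RtoC (/ 2)) * l)
    with (zeta * RtoC ((/ 2 + h) * (Rpower (/ 2 + h) k - P))) in Hd.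
  - rewrite Cmod_mult, Cmod_R in Hd.
    pose proof (Rpower_half_lower k h Hk Hh) as Hlow; fold P in Hlow.
    assert (Hb : (P * k / 2 * h <= (/ 2 + h) * (Rpower (/ 2 + h) k - P))%R).
    { assert (0 <= P * k * h)%R by (repeat apply Rmult_le_pos; lra).
      nra. }
    assert (0 < P * k / 2 * h)%R by (apply Rmult_lt_0_compat; lra).
    rewrite Rabs_pos_eq in Hd by lra.
    pose proof (Cmod_ge_0 zeta).
    apply Rmult_le_reg_r with (P * k / 2 * h)%R; [assumption|].
    rewrite Rmult_assoc in Hd; apply Rle_trans with (2 := Hd).
    now apply Rmult_le_compat_l.
  - rewrite El; unfold radial_map.
    rewrite !Cmod_R, !Rabs_pos_eq by lra; fold P.
    rewrite RtoC_mult, !RtoC_minus, !RtoC_plus; ring.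
Qed.

Lemma radial_map_linear (zeta : C) (k : R) :
  k = 0%R \/ zeta = 0 -> forall z, radial_map zeta k z = zeta * z.
Proof.
  intros [-> | ->] z; unfold radial_map; [|ring].
  (* [Rpower x 0] unfolds to [exp 0] for every [x], so the point [z = 0] needs no separate case. *)
  unfold Rpower; rewrite Rmult_0_l, exp_0; ring.
Qed.

(** * The Berezin range for a linear symbol and its convexity *)

Lemma berezin_range_linear (phi : C -> C) (zeta w : C) :
  (Cmod zeta <= 1)%R -> (forall z, phi z = zeta * z) ->
  berezin_range (composition_operator phi) w <->
  exists s : R, (0 <= s < 1)%R /\ w = RtoC (1 - s) / (1 - zeta * RtoC s).
Proof.
  intros Hzeta Hphi; split.
  - intros [lambda [Hl ->]]; exists (Cmod lambda ^ 2)%R; split.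
    + pose proof (Cmod_ge_0 lambda); red in Hl; nra.
    + now apply berezin_transform_linear.
  (* The transform depends on [lambda] only through its squared modulus, so a real point
     suffices. *)
  - intros [s [Hs ->]]; exists (RtoC (sqrt s)).
    assert (E : (Cmod (RtoC (sqrt s)) ^ 2 = s)%R).
    { rewrite Cmod_R, Rabs_pos_eq by apply sqrt_pos; apply pow2_sqrt; lra. }
    assert (Hd : in_disc (RtoC (sqrt s))).
    { red; pose proof (Cmod_ge_0 (RtoC (sqrt s))); nra. }
    split; [exact Hd|].
    now rewrite (berezin_transform_linear phi zeta), E.
Qed.

(* For real [r < 1] the function [s |-> (1 - s) / (1 - r s)] is an involution
   exchanging [0,1) and (0,1]; for [r = 1] it is the constant 1. *)
Lemma real_mobius_range (r v : R) :
  (-1 <= r < 1 ->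
   (exists s, 0 <= s < 1 /\ v = (1 - s) / (1 - r * s)) <-> 0 < v <= 1)%R.
Proof.
  intros Hr; split.
  - intros [s [Hs ->]].
    assert (0 < 1 - r * s)%R by nra.
    split; [apply Rdiv_lt_0_compat; lra|].
    apply Rmult_le_reg_r with (1 - r * s)%R; [lra|].
    unfold Rdiv; rewrite Rmult_assoc, Rinv_l by lra; nra.
  - intros Hv; assert (0 < 1 - r * v)%R by nra.
    exists ((1 - v) / (1 - r * v))%R; split; [split|].
    + apply Rdiv_le_0_compat; lra.
    + apply Rmult_lt_reg_r with (1 - r * v)%R; [lra|].
      unfold Rdiv; rewrite Rmult_assoc, Rinv_l by lra; nra.
    + field; repeat split; nra.
Qed.

Lemma RtoC_mobius (r s : R) :
  (1 - r * s <> 0)%R ->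
  RtoC (1 - s) / (1 - RtoC r * RtoC s) = RtoC ((1 - s) / (1 - r * s)).
Proof.
  intros H.
  rewrite RtoC_div, !RtoC_minus, RtoC_mult by exact H; reflexivity.
Qed.

Lemma real_rotation_range_convex (phi : C -> C) (r : R) :
  (-1 <= r <= 1)%R -> (forall z, phi z = RtoC r * z) ->
  convex_subset (berezin_range (composition_operator phi)).
Proof.
  intros Hr Hphi.
  assert (Hr' : (Cmod (RtoC r) <= 1)%R)
    by (rewrite Cmod_R; now apply Rabs_le).
  assert (Hne : forall s, (0 <= s < 1 -> 1 - r * s <> 0)%R) by (intros; nra).
  intros x y t Hx Hy Ht.
  apply (berezin_range_linear phi _ _ Hr' Hphi) in Hx, Hy.
  apply (berezin_range_linear phi _ _ Hr' Hphi).
  destruct Hx as [s [Hs ->]], Hy as [u [Hu ->]].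
  rewrite !RtoC_mobius by auto.
  rewrite <- !RtoC_mult, <- RtoC_plus.
  destruct (Req_dec r 1) as [->|Hr1].
  (* For [r = 1] all values equal 1, and the parameter of either endpoint serves. *)
  - exists s; split; [exact Hs|].
    rewrite RtoC_mobius by auto; f_equal; field; split; apply Rgt_not_eq; lra.
  - assert (Hr2 : (-1 <= r < 1)%R) by lra.
    destruct (proj1 (real_mobius_range r _ Hr2) (ex_intro _ s (conj Hs eq_refl))) as [Hx0 Hx1].
    destruct (proj1 (real_mobius_range r _ Hr2) (ex_intro _ u (conj Hu eq_refl))) as [Hy0 Hy1].
    set (X := ((1 - s) / (1 - r * s))%R) in *.
    set (Y := ((1 - u) / (1 - r * u))%R) in *.
    assert (HXY : (0 < (1 - t) * X + t * Y <= 1)%R).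
    (* The combination is at least the smaller of [X] and [Y], hence positive. *)
    { split; [|nra].
      destruct (Rle_dec X Y); [assert (0 <= t * (Y - X))%R by nra
                              |assert (0 <= (1 - t) * (X - Y))%R by nra]; lra. }
    destruct (proj2 (real_mobius_range r _ Hr2) HXY) as [v [Hv E]].
    exists v; split; [exact Hv|].
    now rewrite E, RtoC_mobius by auto.
Qed.

(* The range contains 1 and [1 / (2 - zeta)], the values at [s = 0] and
   [s = 1/2]. Their midpoint is a value [(1 - s) / (1 - zeta s)] only if
   [(zeta - 1) ((zeta - 4) s + 1) = 0], which makes [zeta] real. *)
Lemma convex_range_real (phi : C -> C) (zeta : C) :
  (Cmod zeta <= 1)%R -> (forall z, phi z = zeta * z) ->
  convex_subset (berezin_range (composition_operator phi)) ->
  Im zeta = 0%R.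
Proof.
  intros Hzeta Hphi Hconv.
  pose proof (fun w => berezin_range_linear phi zeta w Hzeta Hphi) as Hrange.
  assert (H0 : berezin_range (composition_operator phi) (RtoC (1 - 0) / (1 - zeta * RtoC 0)))
    by (apply Hrange; exists 0%R; split; [lra|reflexivity]).
  assert (H1 : berezin_range (composition_operator phi)
                 (RtoC (1 - / 2) / (1 - zeta * RtoC (/ 2))))
    by (apply Hrange; exists (/ 2)%R; split; [lra|reflexivity]).
  assert (Ht : (0 <= / 2 <= 1)%R) by lra.
  pose proof (Hconv _ _ _ H0 H1 Ht) as H; clear Hconv H0 H1.
  apply Hrange in H; destruct H as [s [Hs E]].
  assert (Hne : forall u, (0 <= u < 1)%R -> 1 - zeta * RtoC u <> 0).
  { intros u Hu; apply one_minus_neq_0; rewrite Cmod_mult, Cmod_R, Rabs_pos_eq by lra.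
    pose proof (Cmod_ge_0 zeta); nra. }
  pose proof (Hne s Hs) as Hs0.
  assert (H2 : 2 - zeta <> 0).
  { replace (2 - zeta) with (2 * (1 - zeta * RtoC (/ 2))).
    - apply Cmult_neq_0; [apply RtoC_neq; lra | apply Hne; lra].
    - rewrite RtoC_inv by lra; field; apply RtoC_neq; lra. }
  assert (F : (zeta - 1) * ((zeta - 4) * RtoC s + 1) = 0).
  { rewrite !RtoC_minus, RtoC_inv in E by lra.
    (* The left side is the midpoint of 1 and [1 / (2 - zeta)]; clearing denominators then gives the
       factored equation. *)
    assert (E2 : (3 - zeta) / (2 * (2 - zeta)) = (1 - RtoC s) / (1 - zeta * RtoC s)).
    { rewrite <- E; field.
      repeat split; try exact H2; try (apply RtoC_neq; lra). }
    replace ((zeta - 1) * ((zeta - 4) * RtoC s + 1)) with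
      ((3 - zeta) / (2 * (2 - zeta)) * (2 * (2 - zeta) * (1 - zeta * RtoC s))
       - (1 - RtoC s) / (1 - zeta * RtoC s) * (2 * (2 - zeta) * (1 - zeta * RtoC s))).
    - rewrite E2; ring.
    - field; repeat split; trivial; apply RtoC_neq; lra. }
  destruct (Ceq_dec (zeta - 1) 0) as [F1|F1].
  - apply (f_equal Im) in F1; unfold Im in *; simpl in F1; lra.
  - destruct (Ceq_dec ((zeta - 4) * RtoC s + 1) 0) as [F2|F2];
      [|now destruct (Cmult_neq_0 _ _ F1 F2)].
    assert (FR := f_equal Re F2); assert (FI := f_equal Im F2).
    (* At [s = 0] the factor would be 1; otherwise its imaginary part, [s] times that of [zeta],
       forces the claim. *)
    unfold Re, Im in *; simpl in FR, FI; destruct (Req_dec s 0) as [->|Hs1]; [lra|].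
    apply Rmult_eq_reg_r with s; lra.
Qed.

Theorem theorem3p1 (zeta : C) (k : R)
  (hzeta : in_closed_disc zeta) (hk : (0 <= k)%R)
  (hphi : analytic_on_disc (radial_map zeta k)) :
  convex_subset (berezin_range (composition_operator (radial_map zeta k))) <->
  (exists r : R, (-1 <= r <= 1)%R /\ zeta = RtoC r).
Proof.
  pose proof (radial_map_linear zeta k (radial_map_analytic zeta k hk hphi)) as Hlin.
  split.
  - intros Hconv.
    pose proof (convex_range_real _ zeta hzeta Hlin Hconv) as Him.
    assert (E : zeta = RtoC (Re zeta)) by (apply injective_projections; [reflexivity|exact Him]).
    exists (Re zeta); split; [|exact E].
    apply Rabs_le_between, Rle_trans with (2 := hzeta), re_le_Cmod.
  - intros [r [Hr ->]]; exact (real_rotation_range_convex _ r Hr Hlin).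
Qed.
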